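(* Let $M^{2d+1}$ be a contact manifold with contact form $\alpha$, regarded as an shs manifold $(M^{2d+1},\Omega=d\alpha,\alpha)$. Then the SMAT shs connections on $(M^{2d+1},d\alpha,\alpha)$ are not statistical connections; i.e. no SMAT shs connection $(\nabla,\nabla^* )$ has both $\nabla$ and $\nabla^*$ torsion-free.
   Context: A stable Hamiltonian structure (shs) on a smooth manifold $M^{2d+1}$ is a pair $(\Omega,\alpha)$ with $\Omega$ a closed 2-form and $\alpha$ a 1-form such that $\alpha\wedge\Omega^{d}$ is nowhere zero and $\ker\Omega\subset\ker d\alpha$. Its Reeb vector field $E$ is defined by $i_E\Omega=0$, $i_E\alpha=1$. A Riemannian metric $g$ is compatible with $(\Omega,\alpha)$ if there is an endomorphism field $\Theta$ of $TM$ with $\Theta^2=-I+\alpha\otimes E$, $\Theta E=0$, $\alpha\circ\Theta=0$, $\alpha=g(\cdot,E)$, $g=\Omega(\cdot,\Theta\cdot)+\alpha\otimes\alpha$. An SMAT shs connection is a pair $(\nabla,\nabla^* )$ of linear connections dual with respect to a compatible metric $g$, i.e. $X\,g(Y,Z)=g(\nabla_XY,Z)+g(Y,\nabla^*_XZ)$, with $\nabla$ torsion-free, $\nabla E=0$ and $\nabla\Omega=0$. It is statistical if both $\nabla$ and $\nabla^*$ are torsion-free. *)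

(* Defs.v *)
From HB Require Import structures.
From mathcomp Require Import all_boot all_order all_algebra all_fingroup.
From mathcomp Require Import all_classical all_reals all_analysis.
From mathcomp Require Import ring.

Set Implicit Arguments.
Unset Strict Implicit.
Unset Printing Implicit Defensive.

Import Order.TTheory GRing.Theory Num.Theory.
Import numFieldNormedType.Exports.

Local Open Scope classical_set_scope.
Local Open Scope ring_scope.

(* [U] is meant to be open; [Ck k U f] then only depends on the values of [f] *)
(* on [U] (lemma [Ck_eq]).                                                    *)

Fixpoint Ck (R : realType) (n k : nat) (U : set 'rV[R]_n)
    (f : 'rV[R]_n -> R) : Prop :=
  {in U, continuous f} /\
  if k is k'.+1 then
    forall v, {in U, forall x, derivable f x v} /\ Ck k' U ('D_v f)
  else True.

Definition Cinfty (R : realType) (n : nat) (U : set 'rV[R]_n)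
  (f : 'rV[R]_n -> R) : Prop := forall k, Ck k U f.

Section CkTheory.
Variables (R : realType) (n : nat) (U : set 'rV[R]_n).
Hypothesis U_open : open U.
Implicit Types f g : 'rV[R]_n -> R.

Lemma near_in f g : {in U, f =1 g} -> {in U, forall x, {near x, f =1 g}}.
Proof.
move=> fg x /set_mem Ux; have := open_nbhs_nbhs (conj U_open Ux).
by apply: filterS => y Uy; apply: fg; exact: mem_set.
Qed.

Lemma Ck_eq k f g : {in U, f =1 g} -> Ck k U f -> Ck k U g.
Proof.
have ctg (h h' : 'rV[R]_n -> R) :
    {in U, h =1 h'} -> {in U, continuous h} -> {in U, continuous h'}.
  move=> hh' ch x Ux; have cx := ch x Ux.
  rewrite /continuous_at -(hh' _ Ux); apply: cvg_trans cx.
  have nh : {near x, h =1 h'} by exact: near_in.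
  exact: near_eq_cvg nh.
elim: k f g => [|k IH] f g fg [cf df]; split => //; do ?[exact: ctg cf].
move=> v; have [dfv Cfv] := df v; split.
  by move=> x Ux; apply: near_eq_derivable (dfv _ Ux); exact: near_in.
by apply: IH Cfv => x Ux; apply: near_eq_derive; exact: near_in.
Qed.

Lemma Ck_pred k f : Ck k.+1 U f -> Ck k U f.
Proof.
elim: k f => [|k IH] f [cf df]; split => // v.
by have [dfv Cfv] := df v; split => //; exact: IH.
Qed.

Lemma Ck_cst k (c : R) : Ck k U (cst c).
Proof.
elim: k c => [|k IH] c; split => //; do ?[by move=> x _; exact: cst_continuous].
move=> v; split; first by move=> x _; exact: derivable_cst.
apply: (@Ck_eq _ (cst 0)) => // x _.
by rewrite derive_cst.
Qed.

Lemma CkD k f g : Ck k U f -> Ck k U g -> Ck k U (f + g).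
Proof.
elim: k f g => [|k IH] f g [cf df] [cg dg]; split=> //;
  do ?[by move=> x Ux; apply: continuousD; [exact: cf | exact: cg]].
move=> v; have [dfv Cfv] := df v; have [dgv Cgv] := dg v; split.
  by move=> x Ux; apply: derivableD; [exact: dfv | exact: dgv].
apply: Ck_eq (IH _ _ Cfv Cgv) => x Ux.
by rewrite deriveD; [ | exact: dfv | exact: dgv].
Qed.

Lemma CkM k f g : Ck k U f -> Ck k U g -> Ck k U (f * g).
Proof.
elim: k f g => [|k IH] f g Cf Cg; have [cf df] := Cf; have [cg dg] := Cg;
  split=> //; do ?[by move=> x Ux; apply: continuousM; [exact: cf | exact: cg]].
move=> v; have [dfv Cfv] := df v; have [dgv Cgv] := dg v; split.
  by move=> x Ux; apply: derivableM; [exact: dfv | exact: dgv].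
have := CkD (IH _ _ (Ck_pred Cf) Cgv) (IH _ _ (Ck_pred Cg) Cfv).
apply: Ck_eq => x Ux.
by rewrite deriveM; [ | exact: dfv | exact: dgv].
Qed.

End CkTheory.

(* Smooth manifolds without boundary, of pure dimension n.  [cinv c] is a     *)
(* total function, meaningful only on the open set [cmap c @` cdom c].        *)

Record chart (R : realType) (n : nat) (M : topologicalType) := Chart {
  cdom : set M;
  cmap : M -> 'rV[R]_n;
  cinv : 'rV[R]_n -> M;
  cdom_open : open cdom;
  cimg_open : open (cmap @` cdom);
  cmapK : {in cdom, cancel cmap cinv};
  cmap_continuous : {in cdom, continuous cmap};
  cinv_continuous : {in cmap @` cdom, continuous cinv} }.

Record smooth_manifold (R : realType) (n : nat) := SmoothManifold {
  mspace :> topologicalType;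
  mspace_hausdorff : hausdorff_space mspace;
  mspace_second_countable : @second_countable mspace;
  atlas : set (chart R n mspace);
  atlas_cover : forall p : mspace, exists2 c, atlas c & cdom c p;
  atlas_smooth : forall c c', atlas c -> atlas c' -> forall i : 'I_n,
    Cinfty (cmap c @` (cdom c `&` cdom c'))
           (fun y => cmap c' (cinv c y) ord0 i) }.

Definition smooth (R : realType) (n : nat) (M : smooth_manifold R n)
    : {pred M -> R^o} :=
  fun f => `[< forall c, atlas c -> Cinfty (cmap c @` cdom c) (f \o cinv c) >].

Section SmoothClosed.
Variables (R : realType) (n : nat) (M : smooth_manifold R n).

Lemma smooth_cst (a : R) : (cst a : M -> R^o) \in @smooth R n M.
Proof. by apply/asboolP => c _ k; apply: Ck_cst; exact: cimg_open. Qed.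

Lemma smoothD : {in @smooth R n M &, forall f g, f + g \in @smooth R n M}.
Proof.
move=> f g /asboolP sf /asboolP sg; apply/asboolP => c ac k.
exact: (CkD (@cimg_open _ _ _ c) (sf c ac k) (sg c ac k)).
Qed.

Lemma smoothM : {in @smooth R n M &, forall f g, f * g \in @smooth R n M}.
Proof.
move=> f g /asboolP sf /asboolP sg; apply/asboolP => c ac k.
exact: (CkM (@cimg_open _ _ _ c) (sf c ac k) (sg c ac k)).
Qed.

Lemma smoothZ (a : R) :
  {in @smooth R n M, forall f : M -> R^o, a *: f \in @smooth R n M}.
Proof. by move=> f sf; exact: (smoothM (smooth_cst a) sf). Qed.

Lemma smooth_subring_closed : subring_closed (@smooth R n M).
Proof.
split; [exact: smooth_cst | | exact: smoothM].
move=> f g sf sg; apply: smoothD => //.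
by rewrite -scaleN1r; exact: smoothZ.
Qed.

Lemma smooth_submod_closed : submod_closed (@smooth R n M).
Proof.
split; first exact: smooth_cst.
by move=> a f g sf sg; apply: smoothD => //; exact: smoothZ.
Qed.

HB.instance Definition _ :=
  GRing.isSubringClosed.Build (M -> R^o) (@smooth R n M) smooth_subring_closed.
HB.instance Definition _ :=
  GRing.isSubmodClosed.Build R (M -> R^o) (@smooth R n M) smooth_submod_closed.

End SmoothClosed.

Record smooth_fun (R : realType) (n : nat) (M : smooth_manifold R n) :=
  SmoothFun { sfun :> M -> R^o; sfunP : sfun \in @smooth R n M }.

Section SmoothFun.
Variables (R : realType) (n : nat) (M : smooth_manifold R n).
HB.instance Definition _ := [isSub for (@sfun R n M)].
HB.instance Definition _ := [Choice of smooth_fun M by <:].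
HB.instance Definition _ := 
  GRing.SubChoice_isSubComPzRing.Build (M -> R^o) (@smooth R n M) (smooth_fun M)
    (@smooth_subring_closed R n M).
HB.instance Definition _ := [SubZmodule_isSubLmodule of smooth_fun M by <:].
End SmoothFun.

(* Vector fields are the derivations of the R-algebra C^oo(M), and tensor     *)
(* fields are the C^oo(M)-multilinear maps on vector fields; on a Hausdorff   *)
(* second countable manifold this is the same as smooth sections of the       *)
(* tensor bundles.  The value of [X] at [p] is the tangent vector             *)
(* [f |-> X f p].                                                             *)

Definition derivation (R : realType) (n : nat) (M : smooth_manifold R n)
    : {pred smooth_fun M -> (smooth_fun M)^o} :=
  fun X => `[< (forall (a : R) f g, X (a *: f + g) = a *: X f + X g) /\
               (forall f g, X (f * g) = f * X g + g * X f) >].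

Section DerivationClosed.
Variables (R : realType) (n : nat) (M : smooth_manifold R n).
Let C := smooth_fun M.

Lemma smooth_scalerAr (a : R) (f g : C) : a *: (f * g) = f * (a *: g).
Proof.
by apply: val_inj; apply/funext => p /=; exact: (mulrCA a (f p) (g p)).
Qed.

Lemma derivation_submod_closed : submod_closed (@derivation R n M).
Proof.
split; first by apply/asboolP; split=> *; rewrite /= ?scaler0 ?mulr0 addr0.
move=> h X Y /asboolP[lX dX] /asboolP[lY dY]; apply/asboolP; split.
  move=> a f g.
  change (h * X (a *: f + g) + Y (a *: f + g) =
    a *: (h * X f + Y f : C) + (h * X g + Y g) :> C).
  rewrite lX lY (mulrDr h) -smooth_scalerAr scalerDr -!addrA; congr (_ + _).
  by rewrite addrCA.
move=> f g.
change (h * X (f * g) + Y (f * g) =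
  f * (h * X g + Y g) + g * (h * X f + Y f) :> C).
by rewrite dX dY; ring.
Qed.

HB.instance Definition _ :=
  GRing.isSubmodClosed.Build C (C -> C^o) (@derivation R n M)
    derivation_submod_closed.

End DerivationClosed.

Record vfield (R : realType) (n : nat) (M : smooth_manifold R n) := VField {
  vact : smooth_fun M -> (smooth_fun M)^o;
  vactP : vact \in @derivation R n M }.

Definition vapp (R : realType) (n : nat) (M : smooth_manifold R n)
  (X : vfield M) (f : smooth_fun M) : smooth_fun M := vact X f.
Coercion vapp : vfield >-> Funclass.

Section VField.
Variables (R : realType) (n : nat) (M : smooth_manifold R n).
HB.instance Definition _ := [isSub for (@vact R n M)].
HB.instance Definition _ := [Choice of vfield M by <:].
HB.instance Definition _ := [SubChoice_isSubZmodule of vfield M by <:].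
HB.instance Definition _ := [SubZmodule_isSubLmodule of vfield M by <:].

Let C := smooth_fun M.
Implicit Types (X Y Z : vfield M) (f g : C).

Lemma vact_lin X (a : R) f g : X (a *: f + g) = a *: X f + X g.
Proof. by have /asboolP[? ?] := vactP X. Qed.

Lemma vactM X f g : X (f * g) = f * X g + g * X f.
Proof. by have /asboolP[? ?] := vactP X. Qed.

Lemma vactD X f g : X (f + g) = X f + X g.
Proof. by have := vact_lin X 1 f g; rewrite !scale1r. Qed.

Lemma vact0 X : X 0 = 0.
Proof. by apply: (addrI (X 0)); rewrite -vactD !addr0. Qed.

Lemma vactN X f : X (- f) = - X f.
Proof. by apply: (addrI (X f)); rewrite -vactD !subrr vact0. Qed.

Lemma vactB X f g : X (f - g) = X f - X g.
Proof. by rewrite vactD vactN. Qed.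

Lemma vaddE X Y f : (X + Y) f = X f + Y f. Proof. by []. Qed.
Lemma voppE X f : (- X) f = - X f. Proof. by []. Qed.
Lemma vscaleE g X f : (g *: X) f = g * X f. Proof. by []. Qed.

Lemma vfieldP X Y : (forall f, X f = Y f) -> X = Y.
Proof. by move=> XY; apply: val_inj; apply/funext => f; exact: XY. Qed.

Lemma bracket_subproof X Y :
  (fun f => X (Y f) - Y (X f) : C^o) \in @derivation R n M.
Proof.
apply/asboolP; split=> [a f g|f g].
  by rewrite !vact_lin scalerBr opprD addrACA.
by rewrite !(vactM, vactD); ring.
Qed.

Definition bracket X Y : vfield M := VField (bracket_subproof X Y).

Lemma bracketE X Y f : bracket X Y f = X (Y f) - Y (X f).
Proof. by []. Qed.

End VField.

Section DifferentialForms.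
Variables (R : realType) (n : nat) (M : smooth_manifold R n).
Let C := smooth_fun M.
Let V := vfield M.

Definition cochain k := k.-tuple V -> C.

Definition upd k (t : k.-tuple V) (i : 'I_k) (X : V) : k.-tuple V :=
  [tuple if j == i then X else tnth t j | j < k].

Definition is_form k (w : cochain k) : Prop :=
  (forall t i (f : C) X Y,
     w (upd t i (f *: X + Y)) = f * w (upd t i X) + w (upd t i Y)) /\
  (forall t i j, i != j -> tnth t i = tnth t j -> w t = 0).

(* Convention (a /\ b)(X, Y) = a(X) b(Y) - a(Y) b(X) for 1-forms.             *)
Definition wedge k l (a : cochain k) (b : cochain l) : cochain (k + l) :=
  fun t => ((k`! * l`!)%:R : R)^-1 *:
    \sum_(s : {perm 'I_(k + l)}) (-1) ^+ odd_perm s *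
      (a [tuple tnth t (s (lshift l i)) | i < k] *
       b [tuple tnth t (s (rshift k i)) | i < l]).

Fixpoint wedge_pow k (a : cochain k) (m : nat) : cochain (m * k) :=
  if m is m'.+1 return cochain (m * k) then wedge a (@wedge_pow k a m')
  else fun=> 1.

(* Exterior derivatives of 1- and 2-forms by the invariant formula            *)
(* (dw)(X_0, .., X_k) = sum_i (-1)^i X_i w(.., ^X_i, ..)                      *)
(*   + sum_(i < j) (-1)^(i + j) w([X_i, X_j], .., ^X_i, .., ^X_j, ..).        *)
Definition d1 (a : cochain 1) : cochain 2 := fun t =>
  let X := tnth t 0 in let Y := tnth t 1 in
  X (a [tuple Y]) - Y (a [tuple X]) - a [tuple bracket X Y].

Definition d2 (w : cochain 2) : cochain 3 := fun t =>
  let X := tnth t 0 in let Y := tnth t 1 in let Z := tnth t 2 in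
  X (w [tuple Y; Z]) - Y (w [tuple X; Z]) + Z (w [tuple X; Y])
  - w [tuple bracket X Y; Z] + w [tuple bracket X Z; Y]
  - w [tuple bracket Y Z; X].

Definition nowhere_zero k (w : cochain k) : Prop :=
  forall p : M, exists t, w t p != 0.

(* The inclusion of the kernels at every point [p], for tangent vectors       *)
(* written as values [X(p)] of vector fields.                                 *)
Definition sub_ker (w w' : cochain 2) : Prop :=
  forall (p : M) (X : V), (forall Y, w [tuple X; Y] p = 0) ->
    forall Y, w' [tuple X; Y] p = 0.

End DifferentialForms.

Section ContactForm.
Variables (R : realType) (n : nat) (M : smooth_manifold R n).
Variable a : cochain M 1.
Hypothesis a_form : is_form a.
Implicit Types (X Y Z : vfield M) (f g : smooth_fun M).

Lemma form1_lin f X Y : a [tuple f *: X + Y] = f * a [tuple X] + a [tuple Y].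
Proof.
have [lin _] := a_form; have := lin [tuple X] ord0 f X Y.
have updE Z : upd [tuple X] ord0 Z = [tuple Z].
  by apply: eq_from_tnth => i; rewrite tnth_mktuple ord1.
by rewrite !updE.
Qed.

Lemma form1D X Y : a [tuple X + Y] = a [tuple X] + a [tuple Y].
Proof. by have := form1_lin 1 X Y; rewrite scale1r mul1r. Qed.

Lemma form1_0 : a [tuple 0] = 0.
Proof. by apply: (addrI (a [tuple 0])); rewrite -form1D !addr0. Qed.

Lemma form1Z f X : a [tuple f *: X] = f * a [tuple X].
Proof. by have := form1_lin f X 0; rewrite form1_0 !addr0. Qed.

Lemma form1N X : a [tuple - X] = - a [tuple X].
Proof. by rewrite -scaleN1r form1Z mulN1r. Qed.

Lemma bracket_lin f X Y Z :
  bracket (f *: X + Y) Z = f *: bracket X Z + (- Z f) *: X + bracket Y Z.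
Proof.
apply: vfieldP => h; rewrite !(bracketE, vaddE, vscaleE, voppE) !(vactD, vactM).
by ring.
Qed.

Lemma bracketC X Y : bracket X Y = - bracket Y X.
Proof. by apply: vfieldP => h; rewrite voppE !bracketE opprB. Qed.

Lemma d1E X Y :
  d1 a [tuple X; Y] = X (a [tuple Y]) - Y (a [tuple X]) - a [tuple bracket X Y].
Proof. by []. Qed.

Lemma d1C X Y : d1 a [tuple X; Y] = - d1 a [tuple Y; X].
Proof. by rewrite !d1E [bracket Y X]bracketC form1N; ring. Qed.

Lemma d1_lin f X Y Z : d1 a [tuple f *: X + Y; Z] =
  f * d1 a [tuple X; Z] + d1 a [tuple Y; Z].
Proof.
rewrite !d1E bracket_lin !(form1D, form1Z) !(vaddE, vscaleE) !(vactD, vactM).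
by ring.
Qed.

Lemma d1_form : is_form (d1 a).
Proof.
have tE (t : 2.-tuple (vfield M)) : t = [tuple tnth t 0; tnth t 1].
  by apply: eq_from_tnth => -[[|[|//]] i] /=; congr tnth; exact: val_inj.
have upd0 X Y Z : upd [tuple X; Y] 0 Z = [tuple Z; Y].
  by apply: eq_from_tnth => -[[|[|//]] i]; rewrite tnth_mktuple.
have upd1 X Y Z : upd [tuple X; Y] 1 Z = [tuple X; Z].
  by apply: eq_from_tnth => -[[|[|//]] i]; rewrite tnth_mktuple.
have dXX X : d1 a [tuple X; X] = 0.
  have XX0 : bracket X X = 0 by apply: vfieldP => h; rewrite bracketE subrr.
  by rewrite d1E XX0 form1_0 !subrr.
have i01 (i : 'I_2) : i = 0 \/ i = 1.
  by case: i => -[|[|//]] i; [left|right]; exact: val_inj.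
split=> [t i f X Y|t i j].
  rewrite (tE t); case: (i01 i) => ->; rewrite ?upd0 ?upd1; first exact: d1_lin.
  by rewrite d1C d1_lin [in RHS]d1C [d1 _ [tuple _; Y]]d1C; ring.
rewrite (tE t).
by case: (i01 i) => ->; case: (i01 j) => -> // _; rewrite /tnth /= => ->.
Qed.

Lemma d1_closed t : d2 (d1 a) t = 0.
Proof.
rewrite /d2 /=; set X := tnth t 0; set Y := tnth t 1; set Z := tnth t 2.
have jac : bracket (bracket X Y) Z =
    bracket (bracket X Z) Y + - bracket (bracket Y Z) X.
  apply: vfieldP => h; rewrite !(bracketE, vaddE, voppE) !vactB; ring.
by rewrite !d1E jac form1D form1N !vactB /=; ring.
Qed.

End ContactForm.

Record shs (R : realType) (d : nat) (M : smooth_manifold R d.*2.+1) := SHS {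
  Omega : cochain M 2;
  alpha : cochain M 1;
  Omega_form : is_form Omega;
  alpha_form : is_form alpha;
  Omega_closed : forall t, d2 Omega t = 0;
  alpha_Omega_neq0 : nowhere_zero (wedge alpha (@wedge_pow _ _ _ _ Omega d));
  ker_Omega : sub_ker Omega (d1 alpha) }.

Definition contact_form (R : realType) (d : nat)
    (M : smooth_manifold R d.*2.+1) (a : cochain M 1) : Prop :=
  is_form a /\ nowhere_zero (wedge a (@wedge_pow _ _ _ _ (d1 a) d)).

Definition contact_shs (R : realType) (d : nat)
    (M : smooth_manifold R d.*2.+1) (a : cochain M 1)
    (ca : contact_form a) : shs M :=
  {| Omega := d1 a;
     alpha := a;
     Omega_form := d1_form (proj1 ca);
     alpha_form := proj1 ca;
     Omega_closed := d1_closed (proj1 ca);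
     alpha_Omega_neq0 := proj2 ca;
     ker_Omega := fun p X XY => XY |}.

Section Connections.
Variables (R : realType) (n : nat) (M : smooth_manifold R n).
Let C := smooth_fun M.
Let V := vfield M.

(* [exists f, X f p != 0] says that [X] does not vanish at [p].               *)
Definition riemannian_metric (g : V -> V -> C) : Prop :=
  [/\ forall (f : C) X Y Z, g (f *: X + Y) Z = f * g X Z + g Y Z,
      forall X Y, g X Y = g Y X &
      forall (p : M) (X : V), (exists f, X f p != 0) -> 0 < g X X p].

Definition linear_connection (nab : V -> V -> V) : Prop :=
  [/\ forall (f : C) X Y Z, nab (f *: X + Y) Z = f *: nab X Z + nab Y Z,
      forall X Y Z, nab X (Y + Z) = nab X Y + nab X Z &
      forall (X : V) (f : C) Y,
        nab X (f *: Y) = X f *: Y + f *: nab X Y].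

Definition torsion_free (nab : V -> V -> V) : Prop :=
  forall X Y, nab X Y - nab Y X - bracket X Y = 0.

Definition dual_connections (g : V -> V -> C) (nab nabs : V -> V -> V) : Prop :=
  forall X Y Z : V, X (g Y Z) = g (nab X Y) Z + g Y (nabs X Z).

Definition parallel2 (nab : V -> V -> V) (w : cochain M 2) : Prop :=
  forall X Y Z : V,
    X (w [tuple Y; Z]) - w [tuple nab X Y; Z] - w [tuple Y; nab X Z] = 0.

Definition statistical (nab nabs : V -> V -> V) : Prop :=
  torsion_free nab /\ torsion_free nabs.

End Connections.

Section SMAT.
Variables (R : realType) (d : nat) (M : smooth_manifold R d.*2.+1).
Variable S : shs M.
Let C := smooth_fun M.
Let V := vfield M.

Definition is_reeb (E : V) : Prop :=
  (forall X, Omega S [tuple E; X] = 0) /\ alpha S [tuple E] = 1.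

Definition compatible_metric (E : V) (g : V -> V -> C) : Prop :=
  exists Theta : {linear V -> V},
    [/\ forall X, Theta (Theta X) = - X + alpha S [tuple X] *: E,
        Theta E = 0,
        forall X, alpha S [tuple Theta X] = 0,
        forall X, alpha S [tuple X] = g X E &
        forall X Y, g X Y =
          Omega S [tuple X; Theta Y] + alpha S [tuple X] * alpha S [tuple Y]].

Definition SMAT_connection (nab nabs : V -> V -> V) : Prop :=
  [/\ linear_connection nab, linear_connection nabs & exists E g,
    [/\ is_reeb E, riemannian_metric g & compatible_metric E g] /\
    [/\ dual_connections g nab nabs, torsion_free nab,
        forall X, nab X E = 0 & parallel2 nab (Omega S)]].

End SMAT.

(* Main.v *)
Require Import Defs.
From mathcomp Require Import all_boot all_order all_algebra.
From mathcomp Require Import all_classical all_reals all_analysis.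
Local Open Scope classical_set_scope.

Import GRing.Theory.
Local Open Scope ring_scope.

(** Since [E] is parallel for [nab] and [alpha = g(., E)], duality applied to
    the pair [(E, Z)] gives [X (alpha Z) = alpha (nab^*_X Z)]: the form [alpha]
    is parallel for the dual connection.  The exterior derivative of a 1-form
    that is parallel for a connection is [alpha] evaluated on the torsion of
    that connection, so torsion-freeness of [nab^*] forces [d alpha = 0].  Then
    [alpha /\ (d alpha)^d] vanishes identically for [d > 0], which contradicts
    the contact condition at any point of [M]. *)

(** Parallelism expresses the derivatives [X (a Y)] in the Koszul formula for
    [d a] through the connection, so that [d a] becomes [a] applied to the
    torsion. *)
Lemma parallel_torsion_free_closed (R : realType) (n : nat)
    (M : smooth_manifold R n) (a : cochain M 1)
    (nab : vfield M -> vfield M -> vfield M) :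
  is_form a ->
  (forall X Y : vfield M, X (a [tuple Y]) = a [tuple nab X Y]) ->
  torsion_free nab -> forall t, d1 a t = 0.
Proof.
move=> a_form a_par tf t; rewrite /d1 !a_par.
by rewrite -!(form1N a_form) -!(form1D a_form) tf (form1_0 a_form).
Qed.

Lemma dual_parallel_form (R : realType) (n : nat) (M : smooth_manifold R n)
    (g : vfield M -> vfield M -> smooth_fun M) (a : cochain M 1)
    (E : vfield M) (nab nabs : vfield M -> vfield M -> vfield M) :
  riemannian_metric g -> (forall X, a [tuple X] = g X E) ->
  dual_connections g nab nabs -> (forall X, nab X E = 0) ->
  forall X Y : vfield M, X (a [tuple Y]) = a [tuple nabs X Y].
Proof.
move=> [g_lin g_sym _] aE dual parE X Y.
have g0 Z : g 0 Z = 0.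
  by apply: (addrI (g 0 Z)); have := g_lin 1 0 0 Z; rewrite scale1r mul1r !addr0.
by rewrite !aE g_sym dual parE g0 add0r g_sym.
Qed.

Lemma wedge0l (R : realType) (n : nat) (M : smooth_manifold R n) (k l : nat)
    (a : cochain M k) (b : cochain M l) :
  (forall t, a t = 0) -> forall t, wedge a b t = 0.
Proof.
by move=> a0 t; rewrite /wedge big1 ?scaler0 // => s _; rewrite a0 mul0r mulr0.
Qed.

Lemma wedge0r (R : realType) (n : nat) (M : smooth_manifold R n) (k l : nat)
    (a : cochain M k) (b : cochain M l) :
  (forall t, b t = 0) -> forall t, wedge a b t = 0.
Proof.
by move=> b0 t; rewrite /wedge big1 ?scaler0 // => s _; rewrite b0 !mulr0.
Qed.

Lemma wedge_pow0 (R : realType) (n : nat) (M : smooth_manifold R n) (k m : nat)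
    (a : cochain M k) :
  (0 < m)%N -> (forall t, a t = 0) -> forall t, wedge_pow a (m := m) t = 0.
Proof. by case: m => // m _; exact: wedge0l. Qed.

(** For [d = 0] the power [(d a)^0] is the constant 1, and a closed 1-form on a
    curve can be contact; at least one factor [d a] is therefore required. *)
Lemma contact_form_not_closed (R : realType) (d : nat)
    (M : smooth_manifold R d.*2.+1) (a : cochain M 1) :
  (0 < d)%N -> [set: M] !=set0 -> contact_form a -> ~ (forall t, d1 a t = 0).
Proof.
move=> d_gt0 [p _] [_ a_contact] da0; have [t /eqP[]] := a_contact p.
by rewrite wedge0r //; exact: wedge_pow0.
Qed.

Theorem proposition4p9 (R : realType) (d : nat) (d_gt0 : (0 < d)%N)
    (M : smooth_manifold R d.*2.+1) (M_neq0 : [set: M] !=set0)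
    (a : cochain M 1) (contact_a : contact_form a)
    (nab nabs : vfield M -> vfield M -> vfield M) :
  SMAT_connection (contact_shs contact_a) nab nabs -> ~ statistical nab nabs.
Proof.
move=> [_ _ [E [g [[_ g_metric [J [_ _ _ aE _]]] [dual _ parE _]]]]] [_ tfs].
apply: (contact_form_not_closed _ _ _ _ d_gt0 M_neq0 contact_a).
apply: parallel_torsion_free_closed tfs; first exact: proj1 contact_a.
exact: dual_parallel_form g_metric aE dual parE.
Qed.
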